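(* For all sets $X, Y$, the homset $\mathbf{PInj}(X,Y)$ ordered by $f \leq g$ if and only if $f = g f^\dag f$ (equivalently, $\mathrm{Dom}(f) \subseteq \mathrm{Dom}(g)$ and $f(x) = g(x)$ for all $x \in \mathrm{Dom}(f)$) is an algebraic domain. For a directed family of morphisms $f_i \colon X \to Y$ one has $\mathrm{Dom}(\bigvee_i f_i) = \bigcup_i \mathrm{Dom}(f_i)$, and the compact elements are exactly the partial injections with finite domain of definition. Moreover, composition respects this structure (it is monotone and preserves directed suprema), so that $\mathbf{PInj}$ is enriched in algebraic domains.
   Context: $\mathbf{PInj}$ is the category whose objects are sets and whose morphisms $X \to Y$ are partial injections, i.e. partial functions that are injective on their domain of definition, composed as relations. $\mathrm{Dom}(f) \subseteq X$ denotes the domain of definition of $f \colon X \to Y$, and $f^\dag \colon Y \to X$ is the converse relation of $f$ (the inverse partial injection). An algebraic domain is a directed-complete partially ordered set in which every element is the directed supremum of the compact elements below it, where $k$ is compact if $k \leq \bigvee_i f_i$ for a directed family $(f_i)$ implies $k \leq f_i$ for some $i$. *)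

(* Defs.v *)
From Corelib Require Export Relation_Definitions.
From mathcomp Require Export all_boot.
From mathcomp Require Export boolp classical_sets cardinality.

Set Implicit Arguments.
Unset Strict Implicit.
Unset Printing Implicit Defensive.

Local Open Scope classical_set_scope.

(** * Order theory

    Orders are [Prop]-valued relations, and the partial order axioms are part
    of [algebraic_domain].  Directed families are indexed by an arbitrary type
    and are nonempty. *)

Section Domains.
Context {T : Type} (le : T -> T -> Prop).

Definition directed {I : Type} (f : I -> T) : Prop :=
  inhabited I /\ forall i j, exists k, le (f i) (f k) /\ le (f j) (f k).

Definition is_sup {I : Type} (f : I -> T) (s : T) : Prop :=
  (forall i, le (f i) s) /\ (forall t, (forall i, le (f i) t) -> le s t).

Definition directed_complete : Prop :=
  forall (I : Type) (f : I -> T), directed f -> exists s, is_sup f s.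

Definition compact_element (k : T) : Prop :=
  forall (I : Type) (f : I -> T) (s : T),
    directed f -> is_sup f s -> le k s -> exists i, le k (f i).

Definition compact_below (x : T) : {k : T | compact_element k /\ le k x} -> T :=
  @proj1_sig T _.

Record algebraic_domain : Prop := AlgebraicDomain {
  algdom_order : Relation_Definitions.order T le;
  algdom_complete : directed_complete;
  algdom_algebraic :
    forall x, directed (@compact_below x) /\ is_sup (@compact_below x) x
}.

End Domains.

Definition prod_le {S T : Type} (leS : S -> S -> Prop) (leT : T -> T -> Prop)
  (p q : S * T) : Prop := leS p.1 q.1 /\ leT p.2 q.2.

Definition scott_continuous {S T : Type} (leS : S -> S -> Prop)
    (leT : T -> T -> Prop) (F : S -> T) : Prop :=
  (forall x y, leS x y -> leT (F x) (F y)) /\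
  (forall (I : Type) (f : I -> S) (s : S),
     directed leS f -> is_sup leS f s -> is_sup leT (F \o f) (F s)).

(** A category enriched in algebraic domains, the latter forming a category
    with Scott continuous maps and cartesian products.  The unit maps
    [1 -> Hom A A] are automatically continuous. *)

Record algebraic_domain_enriched (Ob : Type) (Hom : Ob -> Ob -> Type)
    (le : forall A B, Hom A B -> Hom A B -> Prop)
    (idm : forall A, Hom A A)
    (comp : forall A B C, Hom B C -> Hom A B -> Hom A C) : Prop :=
  AlgebraicDomainEnriched {
  enriched_compA : forall A B C D (h : Hom C D) (g : Hom B C) (f : Hom A B),
    comp _ _ _ h (comp _ _ _ g f) = comp _ _ _ (comp _ _ _ h g) f;
  enriched_compid : forall A B (f : Hom A B), comp _ _ _ f (idm A) = f;
  enriched_idcomp : forall A B (f : Hom A B), comp _ _ _ (idm B) f = f;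
  enriched_hom : forall A B, algebraic_domain (le A B);
  enriched_comp : forall A B C,
    scott_continuous (prod_le (le B C) (le A B)) (le A C)
      (fun gf => comp A B C gf.1 gf.2)
}.

(** * Partial injections *)

Section Relations.
Local Open Scope relation_scope.

Definition functional X Y (R : set (X * Y)) : Prop :=
  forall x y y', R (x, y) -> R (x, y') -> y = y'.

Lemma functional_diagonal X : functional (@diagonal X).
Proof. by move=> x y y'; rewrite !diagonalP => <- <-. Qed.

Lemma injective_diagonal X : functional (@diagonal X)^-1.
Proof. by move=> x y y'; rewrite /diagonal /= => -> ->. Qed.

Lemma functional_comp X Y Z (S : set (Y * Z)) (R : set (X * Y)) :
  functional S -> functional R -> functional (S \; R).
Proof.
move=> Sf Rf x z z' [y /= xy yz] [y' /= xy' yz']; move: yz'.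
by rewrite -(Rf _ _ _ xy xy'); exact: Sf.
Qed.

Lemma injective_comp X Y Z (S : set (Y * Z)) (R : set (X * Y)) :
  functional S^-1 -> functional R^-1 -> functional (S \; R)^-1.
Proof.
move=> Si Ri z x x' [y /= xy yz] [y' /= xy' yz']; move: xy'.
by rewrite -(Si _ _ _ yz yz'); exact: Ri.
Qed.

End Relations.

Record pinj (X Y : Type) : Type := PInj {
  graph : set (X * Y);
  graph_functional : functional graph;
  graph_injective : functional (graph^-1)%relation
}.

Arguments graph_functional {X Y} f [x y y'] _ _ : rename.
Arguments graph_injective {X Y} f [x y y'] _ _ : rename.

Lemma pinj_ext X Y (f g : pinj X Y) : graph f = graph g -> f = g.
Proof.
case: f g => [f ff fi] [g gf gi] /= fg; case: g / fg gf gi => gf gi.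
by rewrite (Prop_irrelevance ff gf) (Prop_irrelevance fi gi).
Qed.

Definition Dom X Y (f : pinj X Y) : set X := (graph f).`1.

Section Operations.
Local Open Scope relation_scope.

Definition pinj_id X : pinj X X :=
  @PInj X X diagonal (@functional_diagonal X) (@injective_diagonal X).

(* [graph g \; graph f] is the composite "[f], then [g]". *)
Definition pinj_comp X Y Z (g : pinj Y Z) (f : pinj X Y) : pinj X Z :=
  @PInj X Z (graph g \; graph f)
    (functional_comp (graph_functional g) (graph_functional f))
    (injective_comp (graph_injective g) (graph_injective f)).

Definition pinj_dag X Y (f : pinj X Y) : pinj Y X :=
  @PInj Y X (graph f)^-1 (graph_injective f) (graph_functional f).

End Operations.

Definition pinj_le X Y (f g : pinj X Y) : Prop :=
  f = pinj_comp g (pinj_comp (pinj_dag f) f).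

(* Main.v *)
Require Import Defs.
From mathcomp Require Import all_boot.
From mathcomp Require Import boolp classical_sets cardinality.

Set Implicit Arguments.
Unset Strict Implicit.
Unset Printing Implicit Defensive.

Local Open Scope classical_set_scope.

(** The order on partial injections is inclusion of graphs (lemma [pinj_leP]),
    and a directed union of graphs of partial injections is again the graph of
    one: two pairs of the union already lie in a common member, where
    functionality and injectivity apply.  Hence directed suprema are unions of
    graphs ([directed_sup_graph]).

    Given this description, the order theory is that of finite approximations.
    A partial injection with finite domain is compact, because the finitely
    many members of a directed family needed to cover it have a common upper
    bound in the family ([finite_directed_bound]).  Every partial injection is
    the directed union of its restrictions to finite sets
    ([finite_restrictions_sup]), so a compact one is below, hence equal to, such
    a restriction.  This gives both the characterization of compact elements
    and algebraicity.

    Continuity of composition holds because a pair in the composite of two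
    unions uses one pair from each of them, and directedness puts both in
    members with the same index ([pinj_comp_sup]). *)

(** * The order as inclusion of graphs *)

(** The composite [g f^dag f] is the restriction of [g] to the domain of [f], so
    the algebraic order says that [f] is that restriction. *)
Lemma pinj_leP X Y (f g : pinj X Y) : pinj_le f g <-> graph f `<=` graph g.
Proof.
split=> [fE [x y] | fg].
  rewrite {1}fE => -[x' [y' /= fxy' fx'y'] gx'y].
  by rewrite (graph_injective f fxy' fx'y').
apply: pinj_ext; apply/seteqP; split=> [[x y] fxy | [x y] /=].
  by exists x; [exists y | exact: fg].
move=> [x' [y' /= fxy' fx'y'] gx'y].
by rewrite (graph_functional g gx'y (fg _ fx'y')).
Qed.

Lemma pinj_le_Dom X Y (f g : pinj X Y) :
  pinj_le f g <->
  Dom f `<=` Dom g /\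
  forall x, Dom f x -> forall y, graph f (x, y) <-> graph g (x, y).
Proof.
split=> [/pinj_leP fg | [_ fg]].
  split=> [|x [y fxy] y']; first exact: subset_fst_set.
  split=> [|gxy']; first exact: fg.
  by rewrite (graph_functional g gxy' (fg _ fxy)).
by apply/pinj_leP => -[x y] fxy; apply/(fg x) => //; exists y.
Qed.

Lemma pinj_le_order X Y : Relation_Definitions.order (pinj X Y) (@pinj_le X Y).
Proof.
split=> [f|f g h|f g].
- exact/pinj_leP.
- by move=> /pinj_leP fg /pinj_leP gh; apply/pinj_leP; exact: subset_trans gh.
- by move=> /pinj_leP fg /pinj_leP gf; apply: pinj_ext; apply/seteqP.
Qed.

Lemma pinj_comp_le X Y Z (g g' : pinj Y Z) (f f' : pinj X Y) :
  pinj_le g g' -> pinj_le f f' -> pinj_le (pinj_comp g f) (pinj_comp g' f').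
Proof.
move=> /pinj_leP gg /pinj_leP ff; apply/pinj_leP => -[x z] [y /= fxy gyz].
by exists y; [exact: ff | exact: gg].
Qed.

(** * Directed suprema as unions of graphs *)

Section DirectedUnion.
Context {X Y I : Type} (f : I -> pinj X Y).

Lemma bigcup_graph_sup (s : pinj X Y) :
  graph s = \bigcup_i graph (f i) -> is_sup (@pinj_le X Y) f s.
Proof.
move=> sE; split=> [i | t ft]; apply/pinj_leP; rewrite sE.
  by move=> p fp; exists i.
by move=> p [i _]; apply: (pinj_leP _ _).1 (ft i) p.
Qed.

Hypothesis dir_f : directed (@pinj_le X Y) f.

Lemma directed_graph2 i j p q : graph (f i) p -> graph (f j) q ->
  exists k, graph (f k) p /\ graph (f k) q.
Proof.
have [k [/pinj_leP ik /pinj_leP jk]] := dir_f.2 i j.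
by move=> /ik fp /jk fq; exists k.
Qed.

Lemma functional_bigcup : functional (\bigcup_i graph (f i)).
Proof.
move=> x y y' [i _ fi] [j _ fj].
have [k [fk fk']] := directed_graph2 fi fj.
exact: graph_functional fk fk'.
Qed.

Lemma injective_bigcup : functional ((\bigcup_i graph (f i))^-1)%relation.
Proof.
move=> y x x' [i _ fi] [j _ fj].
have [k [fk fk']] := directed_graph2 fi fj.
exact: (graph_injective (f k) fk fk').
Qed.

Definition pinj_bigcup : pinj X Y :=
  PInj functional_bigcup injective_bigcup.

Lemma directed_sup_graph (s : pinj X Y) :
  is_sup (@pinj_le X Y) f s -> graph s = \bigcup_i graph (f i).
Proof.
move=> [fs s_min]; apply/seteqP; split=> [|p [i _]]; last first.
  exact: (pinj_leP _ _).1 (fs i) p.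
have [f_bigcup _] := bigcup_graph_sup (s := pinj_bigcup) erefl.
exact: (pinj_leP _ _).1 (s_min _ f_bigcup).
Qed.

Lemma Dom_directed_sup (s : pinj X Y) :
  is_sup (@pinj_le X Y) f s -> Dom s = \bigcup_i Dom (f i).
Proof.
move=> /directed_sup_graph sE; rewrite /Dom sE; apply/seteqP.
by split=> x [] => [y [i _ fi] | i _ [y fi]];
   [exists i => //; exists y | exists y; exists i].
Qed.

End DirectedUnion.

Lemma pinj_directed_complete X Y : directed_complete (@pinj_le X Y).
Proof.
by move=> I f dir_f; exists (pinj_bigcup dir_f); exact: bigcup_graph_sup.
Qed.

(** * Compact elements and finite restrictions *)

(** In a directed family, finitely many conditions that each hold from some
    member on hold simultaneously at some member. *)
Lemma finite_directed_bound T (le : T -> T -> Prop) I (f : I -> T) X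
    (A : set X) (P : X -> I -> Prop) :
  directed le f -> finite_set A ->
  (forall x i j, le (f i) (f j) -> P x i -> P x j) ->
  (forall x, A x -> exists i, P x i) -> exists i, forall x, A x -> P x i.
Proof.
move=> [[i0] dir_f] finA P_up.
(* Enumerating [A] by a sequence requires a decidable equality on [X]. *)
have /finite_seqP[s ->] : finite_set (A : set {classic X}) by [].
elim: s => [|a s IHs] Ps; first by exists i0.
have [i Pi] : exists i, forall x : {classic X}, x \in s -> P x i.
  by apply: IHs => x xs; apply: Ps; rewrite /= inE xs orbT.
have [j Pj] : exists j, P a j by apply: Ps; rewrite /= inE eqxx.
have [k [ik jk]] := dir_f i j.
exists k => x /=; rewrite inE => /orP[/eqP ->|xs]; first exact: P_up jk Pj.
exact: P_up ik (Pi x xs).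
Qed.

Lemma finite_Dom_compact X Y (k : pinj X Y) :
  finite_set (Dom k) -> compact_element (@pinj_le X Y) k.
Proof.
move=> fink I f s dir_f /(directed_sup_graph dir_f) sE /pinj_leP ks.
have [||i ki] := finite_directed_bound
    (P := fun x i => forall y, graph k (x, y) -> graph (f i) (x, y)) dir_f fink.
- by move=> x i j /pinj_leP ij fi y kxy; exact/ij/fi.
- move=> x [y kxy]; have := ks _ kxy; rewrite sE => -[i _ fi].
  by exists i => y' kxy'; rewrite (graph_functional k kxy' kxy).
by exists i; apply/pinj_leP => -[x y] kxy; apply: ki => //; exists y.
Qed.

Section Restriction.
Context {X Y : Type} (f : pinj X Y).

Lemma functional_restrict (A : set X) :
  functional (graph f `&` [set p | A p.1]).
Proof. by move=> x y y' [fxy _] [fxy' _]; exact: graph_functional fxy fxy'. Qed.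

Lemma injective_restrict (A : set X) :
  functional ((graph f `&` [set p | A p.1])^-1)%relation.
Proof.
by move=> y x x' [fxy _] [fx'y _]; exact: (graph_injective f fxy fx'y).
Qed.

Definition restrict (A : set X) : pinj X Y :=
  PInj (@functional_restrict A) (@injective_restrict A).

Lemma Dom_restrict A : Dom (restrict A) `<=` A.
Proof. by move=> x [y []]. Qed.

Lemma restrict_le A : pinj_le (restrict A) f.
Proof. by apply/pinj_leP => p []. Qed.

Lemma le_restrict (g : pinj X Y) A :
  pinj_le g f -> Dom g `<=` A -> pinj_le g (restrict A).
Proof.
move=> /pinj_leP gf gA; apply/pinj_leP => -[x y] gxy.
by split; [exact: gf | apply: gA; exists y].
Qed.

Lemma restrict_compact A :
  finite_set A -> compact_element (@pinj_le X Y) (restrict A).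
Proof.
by move=> finA; apply/finite_Dom_compact/(sub_finite_set (@Dom_restrict A)).
Qed.

Definition finite_restrictions : {A : set X | finite_set A} -> pinj X Y :=
  fun A => restrict (proj1_sig A).

Lemma finite_restrictions_directed :
  directed (@pinj_le X Y) finite_restrictions.
Proof.
split=> [|[A finA] [B finB]]; first by split; exists set0; exact: finite_set0.
have finAB : finite_set (A `|` B) by rewrite finite_setU.
by exists (exist _ _ finAB); split; apply: le_restrict (restrict_le _) _;
   apply: subset_trans (@Dom_restrict _) _; [exact: subsetUl | exact: subsetUr].
Qed.

(** Singletons already exhaust the graph; general finite sets are what makes
    the family directed. *)
Lemma finite_restrictions_sup : is_sup (@pinj_le X Y) finite_restrictions f.
Proof.
apply: bigcup_graph_sup; apply/seteqP; split=> [[x y] fxy | p [A _ []//]].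
by exists (exist _ _ (finite_set1 x)).
Qed.

End Restriction.

Lemma compact_finite_Dom X Y (k : pinj X Y) :
  compact_element (@pinj_le X Y) k <-> finite_set (Dom k).
Proof.
split=> [k_compact|]; last exact: finite_Dom_compact.
have [[A finA] /pinj_leP kA] :=
  k_compact _ _ _ (finite_restrictions_directed k) (finite_restrictions_sup k)
    (ord_refl _ _ (pinj_le_order X Y) k).
apply: (sub_finite_set _ finA); apply: subset_trans (@Dom_restrict _ _ k A).
exact: subset_fst_set.
Qed.

Lemma pinj_algebraic_domain X Y : algebraic_domain (@pinj_le X Y).
Proof.
split; [exact: pinj_le_order | exact: pinj_directed_complete | move=> f].
pose fin_restrict (A : set X) (finA : finite_set A) :
    {k | compact_element (@pinj_le X Y) k /\ pinj_le k f} :=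
  exist _ (restrict f A) (conj (restrict_compact finA) (restrict_le f A)).
split; split.
- by split; exact: fin_restrict (finite_set0 X).
- move=> [k [k_compact kf]] [l [l_compact lf]].
  have finkl : finite_set (Dom k `|` Dom l).
    by rewrite finite_setU; split; exact/compact_finite_Dom.
  by exists (fin_restrict _ finkl); split; apply: le_restrict.
- by move=> [k []].
- move=> t t_ub; apply: (finite_restrictions_sup f).2 => -[A finA].
  exact: t_ub (fin_restrict _ finA).
Qed.

(** * Continuity of composition *)

(** The hypothesis is joint directedness; it holds for a directed family of
    pairs, and also when one of the families is constant. *)
Lemma pinj_comp_sup X Y Z I (g : I -> pinj Y Z) (f : I -> pinj X Y)
    (t : pinj Y Z) (s : pinj X Y) :
  (forall i j, exists k, pinj_le (g i) (g k) /\ pinj_le (f j) (f k)) ->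
  graph t = \bigcup_i graph (g i) -> graph s = \bigcup_i graph (f i) ->
  is_sup (@pinj_le X Z) (fun i => pinj_comp (g i) (f i)) (pinj_comp t s).
Proof.
move=> dir_gf tE sE; apply: bigcup_graph_sup; rewrite /= tE sE.
apply/seteqP; split=> [[x z] [y /= [j _ fxy] [i _ gyz]] | [x z]].
  have [k [/pinj_leP ik /pinj_leP jk]] := dir_gf i j.
  by exists k => //; exists y; [exact: jk | exact: ik].
by move=> [i _ [y /= fxy gyz]]; exists y; exists i.
Qed.

Lemma graph_bigcup_const X Y I (f : pinj X Y) :
  inhabited I -> graph f = \bigcup_(i : I) graph f.
Proof. by move=> [i0]; apply/seteqP; split=> [p fp|p []//]; exists i0. Qed.

Lemma pinj_comp_supl X Y Z I (g : I -> pinj Y Z) (s : pinj Y Z) (f : pinj X Y) :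
  directed (@pinj_le Y Z) g -> is_sup (@pinj_le Y Z) g s ->
  is_sup (@pinj_le X Z) (fun i => pinj_comp (g i) f) (pinj_comp s f).
Proof.
move=> dir_g g_sup; apply: pinj_comp_sup.
- by move=> i j; exists i; split; exact/pinj_leP.
- exact: directed_sup_graph.
- exact: graph_bigcup_const dir_g.1.
Qed.

Lemma pinj_comp_supr X Y Z I (g : pinj Y Z) (f : I -> pinj X Y) (s : pinj X Y) :
  directed (@pinj_le X Y) f -> is_sup (@pinj_le X Y) f s ->
  is_sup (@pinj_le X Z) (fun i => pinj_comp g (f i)) (pinj_comp g s).
Proof.
move=> dir_f f_sup; apply: pinj_comp_sup.
- by move=> i j; exists j; split; exact/pinj_leP.
- exact: graph_bigcup_const dir_f.1.
- exact: directed_sup_graph.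
Qed.

Section ProductOrder.
Context {S T I : Type} (leS : S -> S -> Prop) (leT : T -> T -> Prop).
Context (f : I -> S * T).

Lemma directed_fst : directed (prod_le leS leT) f -> directed leS (fst \o f).
Proof.
move=> [I0 dir_f]; split=> // i j.
by have [k [[? _] [? _]]] := dir_f i j; exists k.
Qed.

Lemma directed_snd : directed (prod_le leS leT) f -> directed leT (snd \o f).
Proof.
move=> [I0 dir_f]; split=> // i j.
by have [k [[_ ?] [_ ?]]] := dir_f i j; exists k.
Qed.

(** Replacing one component of an upper bound by another bound for that
    component gives an upper bound again. *)
Lemma is_sup_fst p : is_sup (prod_le leS leT) f p -> is_sup leS (fst \o f) p.1.
Proof.
move=> [fp p_min]; split=> [i | a fa]; first exact: (fp i).1.
by apply: (p_min (a, p.2) _).1 => i; split; [exact: fa | exact: (fp i).2].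
Qed.

Lemma is_sup_snd p : is_sup (prod_le leS leT) f p -> is_sup leT (snd \o f) p.2.
Proof.
move=> [fp p_min]; split=> [i | b fb]; first exact: (fp i).2.
by apply: (p_min (p.1, b) _).2 => i; split; [exact: (fp i).1 | exact: fb].
Qed.

End ProductOrder.

Lemma pinj_comp_scott X Y Z :
  scott_continuous (prod_le (@pinj_le Y Z) (@pinj_le X Y)) (@pinj_le X Z)
    (fun gf => pinj_comp gf.1 gf.2).
Proof.
split=> [gf gf' [gg ff] | I gf p dir_gf gf_sup]; first exact: pinj_comp_le.
apply: (pinj_comp_sup (g := fst \o gf) (f := snd \o gf)).
- move=> i j; have [k [[gik _] [_ fjk]]] := dir_gf.2 i j.
  by exists k.
- exact: directed_sup_graph (directed_fst dir_gf) _ (is_sup_fst gf_sup).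
- exact: directed_sup_graph (directed_snd dir_gf) _ (is_sup_snd gf_sup).
Qed.

Lemma pinj_enriched : algebraic_domain_enriched pinj_le pinj_id pinj_comp.
Proof.
split.
- move=> A B C D h g f; apply: pinj_ext; apply/seteqP; split=> -[a d] /=.
    by move=> [c [b ? ?] ?]; exists b => //; exists c.
  by move=> [b ? [c ? ?]]; exists c => //; exists b.
- move=> A B f; apply: pinj_ext; apply/seteqP; split=> -[a b] /=.
    by move=> [a' /= /diagonalP ->].
  by exists a.
- move=> A B f; apply: pinj_ext; apply/seteqP; split=> -[a b] /=.
    by move=> [b' fab' /= /diagonalP <-].
  by exists b.
- exact: pinj_algebraic_domain.
- exact: pinj_comp_scott.
Qed.

Theorem mainTheorem6 :
  (forall X Y : Type,
    [/\ algebraic_domain (@pinj_le X Y),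
        (forall f g : pinj X Y,
           pinj_le f g <->
           Dom f `<=` Dom g /\
           forall x, Dom f x -> forall y, graph f (x, y) <-> graph g (x, y)),
        (forall (I : Type) (f : I -> pinj X Y) (s : pinj X Y),
           directed (@pinj_le X Y) f -> is_sup (@pinj_le X Y) f s ->
           Dom s = \bigcup_i Dom (f i)) &
        (forall k : pinj X Y,
           compact_element (@pinj_le X Y) k <-> finite_set (Dom k))]) /\
  (forall X Y Z : Type,
    [/\ (forall (g g' : pinj Y Z) (f f' : pinj X Y),
           pinj_le g g' -> pinj_le f f' ->
           pinj_le (pinj_comp g f) (pinj_comp g' f')),
        (forall (I : Type) (g : I -> pinj Y Z) (s : pinj Y Z) (f : pinj X Y),
           directed (@pinj_le Y Z) g -> is_sup (@pinj_le Y Z) g s ->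
           is_sup (@pinj_le X Z) (fun i => pinj_comp (g i) f)
             (pinj_comp s f)) &
        (forall (I : Type) (g : pinj Y Z) (f : I -> pinj X Y) (s : pinj X Y),
           directed (@pinj_le X Y) f -> is_sup (@pinj_le X Y) f s ->
           is_sup (@pinj_le X Z) (fun i => pinj_comp g (f i))
             (pinj_comp g s))]) /\
  algebraic_domain_enriched pinj_le pinj_id pinj_comp.
Proof.
split; [|split; last exact: pinj_enriched].
  move=> X Y; split.
  - exact: pinj_algebraic_domain.
  - exact: pinj_le_Dom.
  - by move=> I f s dir_f; exact: Dom_directed_sup.
  - exact: compact_finite_Dom.
move=> X Y Z; split.
- exact: pinj_comp_le.
- exact: pinj_comp_supl.
- exact: pinj_comp_supr.
Qed.
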